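(* Let $N, K, T, M$ be positive integers with $K \le N$, $T\le N$ and $T+K\le N$. Then there exists an $(N,K,T;M)$-PIR scheme with rate $(1+R+R^2+\cdots+R^{M-1})^{-1}$, where $R=1-\frac{\binom{N-T}{K}}{\binom{N}{K}}$.
   Context: An $(N,K,T;M)$-PIR scheme is defined as follows. A distributed storage system has $N$ servers storing $M$ files $W^{[1]},\dots,W^{[M]}\in\mathbb{F}_q^{L\times K}$ (for some positive integer $L$ and some finite field $\mathbb{F}_q$, both of which the scheme may choose, $q$ large enough). The files are independent and uniformly distributed, so $H(W^{[m]})=LK$ (in $q$-ary units) and $H(W^{[1]},\dots,W^{[M]})=MLK$. Let $\mathbf{w}^{[m]}_j\in\mathbb{F}_q^K$ be the $j$-th row of $W^{[m]}$. Each file is stored with the same arbitrary given $(N,K)$-MDS code with generator matrix $\mathbf{G}=[\mathbf{g}_1\ \cdots\ \mathbf{g}_N]\in\mathbb{F}_q^{K\times N}$ (any $K$ columns linearly independent): server $n$ stores $\mathbf{y}_n=(\mathbf{w}^{[m]}_j\mathbf{g}_n)_{1\le m\le M,\,1\le j\le L}$. A user wishing to retrieve file $W^{[i]}$ uses private randomness $\mathcal{F}$ (unknown to servers); the servers may use common randomness $\mathcal{G}$ (known to the user); $\mathcal{F},\mathcal{G},i,W^{[1]},\dots,W^{[M]}$ are mutually independent. The user sends query $Q^{[i]}_n$ to server $n$, with $I(Q^{[i]}_1,\dots,Q^{[i]}_N;W^{[1]},\dots,W^{[M]})=0$; server $n$ returns an answer $A^{[i]}_n$ that is a deterministic function of $Q^{[i]}_n$,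 $\mathcal{G}$ and $\mathbf{y}_n$. Correctness: $H(W^{[i]}\mid Q^{[i]}_{1:N},A^{[i]}_{1:N},\mathcal{F},\mathcal{G})=0$. $T$-privacy: for every set $\mathcal{T}\subseteq\{1,\dots,N\}$ with $|\mathcal{T}|=T$, $I(i;Q^{[i]}_{\mathcal{T}})=I(i;A^{[i]}_{\mathcal{T}})=0$, where $Q^{[i]}_{\mathcal{T}}=\{Q^{[i]}_n:n\in\mathcal{T}\}$ and similarly for $A$. The rate of the scheme is $H(W^{[i]})/\sum_{n=1}^N H(A^{[i]}_n)$. The scheme is required to work for any underlying $(N,K)$-MDS storage code. *)

(* Defs.v *)
From HB Require Import structures.
From mathcomp Require Import all_boot all_order all_algebra.
From mathcomp Require Import reals exp.

Set Implicit Arguments.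
Unset Strict Implicit.
Unset Printing Implicit Defensive.

Import Order.TTheory GRing.Theory Num.Theory.
Local Open Scope ring_scope.

(* Finite information theory.  A probability space is a finite type    *)
(* Omega with a pmf P; random variables are functions on Omega with    *)
(* values in finite types.  Entropies are in nats (natural log); the   *)
(* base only rescales entropies, so rates / zero-ness are unaffected.   *)
Section Info.
Variable R : realType.
Variables (Omega : finType) (P : Omega -> R).

Definition is_pmf (T : finType) (p : T -> R) :=
  (forall t, 0 <= p t) /\ \sum_(t : T) p t = 1.

Definition law (A : finType) (X : Omega -> A) (a : A) : R :=
  \sum_(w | X w == a) P w.

(* Shannon entropy H(X) (convention 0 ln 0 = 0 holds since ln 0 = 0) *)
Definition entropy (A : finType) (X : Omega -> A) : R :=
  - \sum_(a : A) law X a * ln (law X a).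

Definition cond_entropy (A B : finType) (X : Omega -> A) (Y : Omega -> B) : R :=
  entropy (fun w => (X w, Y w)) - entropy Y.

Definition mutual_info (A B : finType) (X : Omega -> A) (Y : Omega -> B) : R :=
  entropy X + entropy Y - entropy (fun w => (X w, Y w)).
End Info.

Definition MDS_gen (F : fieldType) (K N : nat) (G : 'M[F]_(K, N)) :=
  forall f : 'I_K -> 'I_N, injective f -> \rank (colsub f G) = K.

Definition files_t (F : finFieldType) (M L K : nat) :=
  {ffun 'I_M -> 'M[F]_(L, K)}.

Definition store (F : finFieldType) (M L K N : nat) (G : 'M[F]_(K, N))
  (W : files_t F M L K) (n : 'I_N) : 'M[F]_(M, L) :=
  \matrix_(m < M, j < L) ((W m *m G) j n).

(* A PIR scheme with subpacketization L over the field F.               *)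
(* The user's private randomness (type user_rand, law user_pmf) and the *)
(* servers' common randomness (serv_rand, serv_pmf) are arbitrary       *)
(* finite random variables.  The query to server n for desired index i  *)
(* is the deterministic function  query i F n  of i and the user's      *)
(* randomness; the answer of server n is the deterministic function     *)
(* answer n Q_n G y_n.                                                  *)
Record PIR_scheme (R : realType) (F : finFieldType) (N M L : nat) := PIRScheme {
  user_rand : finType;
  user_pmf : user_rand -> R;
  serv_rand : finType;
  serv_pmf : serv_rand -> R;
  query_alph : finType;
  query : 'I_M -> user_rand -> 'I_N -> query_alph;
  ans_alph : finType;
  answer : 'I_N -> query_alph -> serv_rand -> 'M[F]_(M, L) -> ans_alph
}.
Arguments user_rand {R F N M L} p.
Arguments user_pmf {R F N M L} p _.
Arguments serv_rand {R F N M L} p.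
Arguments serv_pmf {R F N M L} p _.
Arguments query_alph {R F N M L} p.
Arguments query {R F N M L} p _ _ _.
Arguments ans_alph {R F N M L} p.
Arguments answer {R F N M L} p _ _ _ _.

Section Scheme.
Variables (R : realType) (F : finFieldType) (N K M L : nat).
Variable (G : 'M[F]_(K, N)).
Variable (S : PIR_scheme R F N M L).

(* Sample space for a fixed desired index i:
   (user randomness, common randomness, files), mutually independent,
   files uniform. *)
Definition omega := (user_rand S * serv_rand S * files_t F M L K)%type.

Definition omega_pmf (x : omega) : R :=
  user_pmf S x.1.1 * serv_pmf S x.1.2 / (#|{: files_t F M L K}|%:R).

Definition RV_file (m : 'I_M) (x : omega) : 'M[F]_(L, K) := x.2 m.
Definition RV_files (x : omega) : files_t F M L K := x.2.
Definition RV_query (i : 'I_M) (n : 'I_N) (x : omega) : query_alph S :=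
  query S i x.1.1 n.
Definition RV_answer (i : 'I_M) (n : 'I_N) (x : omega) : ans_alph S :=
  answer S n (query S i x.1.1 n) x.1.2 (store G x.2 n).
Definition RV_queries (i : 'I_M) (x : omega) : {ffun 'I_N -> query_alph S} :=
  [ffun n => RV_query i n x].
Definition RV_answers (i : 'I_M) (x : omega) : {ffun 'I_N -> ans_alph S} :=
  [ffun n => RV_answer i n x].

(* Sample space where the desired index i is itself a random variable,
   uniform on 'I_M and independent of everything else. *)
Definition omegaI := ('I_M * omega)%type.
Definition omegaI_pmf (ix : omegaI) : R := (M%:R)^-1 * omega_pmf ix.2.

Definition RV_index (ix : omegaI) : 'I_M := ix.1.
Definition RV_queries_T (Tset : {set 'I_N}) (ix : omegaI)
  : {ffun 'I_N -> option (query_alph S)} :=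
  [ffun n => if n \in Tset then Some (RV_query ix.1 n ix.2) else None].
Definition RV_answers_T (Tset : {set 'I_N}) (ix : omegaI)
  : {ffun 'I_N -> option (ans_alph S)} :=
  [ffun n => if n \in Tset then Some (RV_answer ix.1 n ix.2) else None].

Definition is_PIR_scheme (T : nat) : Prop :=
  [/\ is_pmf (user_pmf S), is_pmf (serv_pmf S),
      (forall i : 'I_M, mutual_info omega_pmf (RV_queries i) RV_files = 0),
      (forall i : 'I_M,
         cond_entropy omega_pmf (RV_file i)
           (fun x => (RV_queries i x, RV_answers i x, x.1.1, x.1.2)) = 0) &
      (forall Tset : {set 'I_N}, #|Tset| = T ->
         mutual_info omegaI_pmf RV_index (RV_queries_T Tset) = 0 /\
         mutual_info omegaI_pmf RV_index (RV_answers_T Tset) = 0)].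

Definition PIR_rate (i : 'I_M) : R :=
  entropy omega_pmf (RV_file i) /
  \sum_(n < N) entropy omega_pmf (RV_answer i n).
End Scheme.

Definition target_rate (R : realType) (N K T M : nat) : R :=
  let r := 1 - ('C(N - T, K))%:R / ('C(N, K))%:R in
  (\sum_(m < M) r ^+ m)^-1.

(* Main.v *)
(* Every K-subset b of the N servers acts as one virtual server: its members are
   sent the same query vectors, and the MDS property turns their K answers into
   the value of the query in F^K.  There are alpha = C(N, K) virtual servers, all
   replicated, and T colluding servers see tau = C(N, K) - C(N - T, K) of them, so
   it suffices to run a Sun-Jafar scheme for tau-private retrieval from alpha
   replicated databases, whose rate is governed by R = tau / alpha.

   In that scheme the queries to b are indexed by words v in [alpha]^M with a
   letter v_m >= tau; file m enters the query iff v_m >= tau.  There are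
   alpha^M - tau^M such words, and alpha^M (alpha - tau) pairs (b, v) involve a
   given file, whence the rate.  Each file is first hidden by a uniformly random
   change of basis.  The interference of undesired files is coded by a
   Reed-Solomon code across the virtual servers, with just enough queries free of
   the desired file to determine it; for tau virtual servers the coded rows are
   as independent as the uncoded ones, hence privacy. *)
Require Import Defs.
From HB Require Import structures.
From mathcomp Require Import all_boot all_order all_algebra.
From mathcomp Require Import reals exp.
From mathcomp Require Import zify ring.
Import Order.TTheory GRing.Theory Num.Theory.
Local Open Scope ring_scope.

(** * Entropies from measure-preserving maps *)

Section FiniteInformation.
Context {R : realType} {Omega : finType} (P : Omega -> R).
Hypothesis pmfP : is_pmf P.

Let P_ge0 w : 0 <= P w. Proof. by case: pmfP. Qed.

Lemma law_ge0 {A : finType} (X : Omega -> A) a : 0 <= law P X a.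
Proof. exact: sumr_ge0. Qed.

Lemma sum_law {A : finType} (X : Omega -> A) : \sum_a law P X a = 1.
Proof.
by case: pmfP => _ <-; rewrite (partition_big X xpredT).
Qed.

Lemma sum_law_pairl {A B : finType} (X : Omega -> A) (Y : Omega -> B) b :
  \sum_a law P (fun w => (X w, Y w)) (a, b) = law P Y b.
Proof.
rewrite /law (partition_big X xpredT) //=; apply: eq_bigr => a _.
by apply: eq_bigl => w; rewrite xpair_eqE andbC.
Qed.

Lemma law_le_inj {A : finType} (X : Omega -> A) a a' (h : Omega -> Omega) :
  {in [pred w | X w == a] &, injective h} ->
  (forall w, X w = a -> P (h w) = P w /\ X (h w) = a') ->
  law P X a <= law P X a'.
Proof.
move=> h_inj hP; rewrite /law.
have -> : \sum_(w | X w == a) P w = \sum_(w in [set h x | x in [pred w | X w == a]]) P w.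
  rewrite big_imset //=; apply: eq_bigr => w /eqP /hP [-> //].
rewrite [leRHS](bigID (fun w => w \in [set h x | x in [pred w | X w == a]])) /=.
rewrite [X in _ <= X + _](eq_bigl (fun w => w \in [set h x | x in [pred w | X w == a]])).
  by rewrite lerDl sumr_ge0.
move=> w /=; apply: andb_idl => /imsetP [x /eqP Xx ->].
by case: (hP x Xx) => _ ->.
Qed.

(** Weight-preserving injections between the fibres of [X] force all values in [E] to be equally
    likely. *)
Lemma entropy_uniform {A : finType} (X : Omega -> A) (E : {set A}) :
  (forall w, X w \in E) ->
  (forall a a', a \in E -> a' \in E -> exists h : Omega -> Omega,
     {in [pred w | X w == a] &, injective h} /\
     forall w, X w = a -> P (h w) = P w /\ X (h w) = a') ->
  entropy P X = ln (#|E|%:R).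
Proof.
move=> XE hX.
have law0 a : a \notin E -> law P X a = 0.
  move=> aE; rewrite /law big1 // => w /eqP Xw.
  by move: (XE w); rewrite Xw (negbTE aE).
have lawle a a' : a \in E -> a' \in E -> law P X a <= law P X a'.
  by move=> aE a'E; have [h [h1 h2]] := hX a a' aE a'E; exact: law_le_inj h1 h2.
have sumE : \sum_(a in E) law P X a = 1.
  rewrite -(sum_law X) [RHS](bigID (mem E)) /= [X in _ + X]big1 ?addr0 //.
have E0 : (0 < #|E|)%N.
  rewrite lt0n; apply/eqP => /cards0_eq E0; move/eqP: sumE.
  by rewrite E0 big_set0 eq_sym oner_eq0.
have lawE a : a \in E -> law P X a = (#|E|%:R)^-1.
  move=> aE; have n0 : (#|E|%:R : R) != 0 by rewrite pnatr_eq0 -lt0n.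
  apply: (mulIf n0); rewrite mulVf // mulr_natr -sumr_const -[RHS]sumE.
  by apply: eq_bigr => a' a'E; apply/le_anti; rewrite !lawle.
rewrite /entropy (bigID (mem E)) /= [X in _ + X]big1 ?addr0; last first.
  by move=> a aE; rewrite law0 // mul0r.
rewrite (eq_bigr (fun a => (#|E|%:R)^-1 * ln ((#|E|%:R)^-1))).
  rewrite sumr_const lnV ?posrE ?ltr0n // -(mulr_natl (_ * _)) mulrA mulfV ?mul1r ?opprK //.
  by rewrite pnatr_eq0 -lt0n.
by move=> a aE; rewrite lawE.
Qed.

(** [h] moves the value of [X] while fixing [Y], so given [Y] the variable [X] is uniform. Privacy
    and query independence both reduce to exhibiting such an [h]. *)
Lemma mutual_info_symmetry {A B : finType} (X : Omega -> A) (Y : Omega -> B) :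
  (forall a a', exists h : Omega -> Omega,
     {in [pred w | X w == a] &, injective h} /\
     forall w, X w = a -> [/\ P (h w) = P w, X (h w) = a' & Y (h w) = Y w]) ->
  mutual_info P X Y = 0.
Proof.
move=> hX; rewrite /mutual_info.
have hXset : entropy P X = ln (#|[set: A]|%:R).
  apply: entropy_uniform => [w|a a' _ _]; first by rewrite inE.
  by have [h [h1 h2]] := hX a a'; exists h; split=> // w /h2 [].
rewrite cardsT in hXset.
have A0 : (0 < #|A|)%N.
  case: pmfP => _ s1; apply/card_gt0P.
  case: (pickP (@predT Omega)) => [w _|e]; first by exists (X w).
  by move/eqP: s1; rewrite big_pred0 // eq_sym oner_eq0.
have n0 : (#|A|%:R : R) != 0 by rewrite pnatr_eq0 -lt0n.
have joint a b : law P (fun w => (X w, Y w)) (a, b) = law P Y b / #|A|%:R.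
  apply: (mulIf n0); rewrite mulfVK // -(sum_law_pairl X Y) mulr_natr.
  rewrite -[LHS]sumr_const; apply: eq_big => // a' _.
  have le1 c c' : law P (fun w => (X w, Y w)) (c, b) <= law P (fun w => (X w, Y w)) (c', b).
    have [h [h1 h2]] := hX c c'; apply: (law_le_inj _ _ _ h).
      by move=> w w'; rewrite !inE !xpair_eqE => /andP[? _] /andP[? _]; exact: h1.
    by move=> w [/h2 [-> -> ->] ->].
  by apply/le_anti; rewrite !le1.
rewrite hXset {2}/entropy.
rewrite (_ : \sum_ab _ = \sum_b law P Y b * (ln (law P Y b) - ln #|A|%:R)); last first.
  rewrite -(pair_bigA _ (fun a b => law P (fun w => (X w, Y w)) (a, b)
     * ln (law P (fun w => (X w, Y w)) (a, b)))) exchange_big /=.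
  apply: eq_bigr => b _; under eq_bigr do rewrite joint.
  rewrite sumr_const -mulrnAl -(mulr_natr (_ / _)) divfK //.
  have [->|nz] := eqVneq (law P Y b) 0; first by rewrite !mul0r.
  by rewrite ln_div ?posrE ?ltr0n // lt_neqAle eq_sym nz law_ge0.
under [in X in - X]eq_bigr do rewrite mulrBr.
rewrite sumrB -mulr_suml sum_law mul1r /entropy opprK.
by rewrite -addrA addKr subrr.
Qed.

Lemma mutual_infoC {A B : finType} (X : Omega -> A) (Y : Omega -> B) :
  mutual_info P X Y = mutual_info P Y X.
Proof.
rewrite /mutual_info [entropy P X + _]addrC; congr (_ - _); rewrite /entropy.
congr (- _); rewrite (reindex (fun ba : B * A => (ba.2, ba.1))) /=; last first.
  by exists (fun ab : A * B => (ab.2, ab.1)) => [] [].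
apply: eq_bigr => -[b a] _ /=; rewrite (_ : law P _ (a, b) = law P (fun w => (Y w, X w)) (b, a)) //.
by rewrite /law; apply: eq_bigl => w; rewrite !xpair_eqE andbC.
Qed.

(** The joint law lives on the graph of a function of [Y], so its entropy is that of [Y]. *)
Lemma cond_entropy_determined {A B : finType} (X : Omega -> A) (Y : Omega -> B) :
  (forall w w', Y w = Y w' -> X w = X w') -> cond_entropy P X Y = 0.
Proof.
move=> XY; apply/eqP; rewrite subr_eq0 /entropy eqr_opp; apply/eqP.
rewrite -(pair_bigA _ (fun a b => law P (fun w => (X w, Y w)) (a, b)
     * ln (law P (fun w => (X w, Y w)) (a, b)))) exchange_big /=.
apply: eq_bigr => b _.
case: (pickP [pred w | Y w == b]) => [w0 /eqP Yw0|Yb]; last first.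
  rewrite [law P Y b]big_pred0 // mul0r big1 // => a _.
  by rewrite /law big_pred0 ?mul0r // => w; rewrite xpair_eqE andbC; have /= -> := Yb w.
have lawE a : law P (fun w => (X w, Y w)) (a, b) = if a == X w0 then law P Y b else 0.
  case: eqP => [->|aX].
    rewrite /law; apply: eq_bigl => w; rewrite xpair_eqE; apply: andb_idl.
    by move/eqP=> Yw; apply/eqP/XY; rewrite Yw.
  rewrite /law big_pred0 // => w; apply/negP; rewrite xpair_eqE.
  by case/andP=> /eqP Xw /eqP Yw; apply: aX; rewrite -Xw; apply: XY; rewrite Yw.
rewrite (bigD1 (X w0)) //= big1 ?addr0 => [|a /negbTE aX]; first by rewrite lawE eqxx.
by rewrite lawE aX mul0r.
Qed.

End FiniteInformation.

(** * Virtual servers: coded queries, decoding and hiding *)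

Lemma card_ord_lt {n k : nat} : (k <= n)%N -> #|[set c : 'I_n | (c < k)%N]| = k.
Proof.
move=> kn; have widen_inj : injective (widen_ord kn).
  by move=> c d /(congr1 val) /= cd; exact: val_inj.
rewrite -[RHS](card_ord k) -[RHS]cardsT -[RHS](card_imset _ widen_inj).
apply: eq_card => c; rewrite inE; apply/idP/imsetP => [ck|[d _ ->] //=].
by exists (Ordinal ck); rewrite ?inE //; exact: val_inj.
Qed.

Section VirtualServers.
Context {F : fieldType} {a tau M L : nat}.
Local Notation vserver := 'I_a.+1.
Local Notation word := {ffun 'I_M -> 'I_a.+1}.
Local Notation slot := ('I_a.+1 * {ffun 'I_M -> 'I_a.+1})%type.

Context (x : vserver -> F) (idx : 'I_M -> 'I_L -> slot) (rk : 'I_M -> slot -> 'I_L).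
Hypothesis x_inj : injective x.
Hypothesis tau_le : (tau <= a.+1)%N.
Hypothesis idx_rk : forall m (s : slot), (tau <= s.2 m)%N -> idx m (rk m s) = s.
Hypothesis rk_idx : forall m, cancel (idx m) (rk m).
Hypothesis idx_act : forall m j, (tau <= (idx m j).2 m)%N.

(** Addition in ['I_a.+1] is modulo [a.+1], so shifting letter [i] permutes the words. *)
Definition shift (i : 'I_M) (c : vserver) (v : word) : word :=
  [ffun m => if m == i then v m + c else v m].

Lemma shiftK i c : cancel (shift i c) (shift i (- c)).
Proof. by move=> v; apply/ffunP => m; rewrite !ffunE; case: eqP => // _; rewrite addrK. Qed.

Lemma shiftNK i c : cancel (shift i (- c)) (shift i c).
Proof. by move=> v; apply/ffunP => m; rewrite !ffunE; case: eqP => // _; rewrite subrK. Qed.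

Lemma shift_neq i c v m : m != i -> shift i c v m = v m.
Proof. by rewrite ffunE => /negbTE ->. Qed.

(* A slot (b, v) is a query to virtual server b; file m takes part in it when
   v m >= tau.  The desired file i contributes the fresh symbol (b, v).  Every
   other file m contributes the Reed-Solomon combination, with exponents t < tau
   and evaluation point x b, of the symbols (t, v') where v' subtracts b from
   the i-th letter of v: for fixed v', exactly tau of the a.+1 values of b give
   v i < tau, that is a slot not involving file i. *)
Definition coef (i m : 'I_M) (s s' : slot) : F :=
  if m == i then (s == s')%:R
  else if (s'.1 < tau)%N && (s'.2 == shift i (- s.1) s.2) then x s.1 ^+ s'.1 else 0.

(** Column [j] stands for the symbol [idx m j], where [idx m] enumerates the slots in which file [m]
    takes part. *)
Definition qrow (i m : 'I_M) (s : slot) : 'rV[F]_L :=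
  if (tau <= s.2 m)%N then \row_j coef i m s (idx m j) else 0.

(** For [b] in [Ts], pairing [y] with the polynomial of degree [tau - 1] vanishing on the rest of
    [Ts] isolates [y b]. This serves privacy. *)
Lemma vandermonde_supp (Ts : {set vserver}) (y : vserver -> F) :
  #|Ts| = tau -> (forall b, b \notin Ts -> y b = 0) ->
  (forall t, (t < tau)%N -> \sum_b y b * x b ^+ t = 0) -> forall b, y b = 0.
Proof.
move=> cTs y0 yx b; have [bT|/y0 //] := boolP (b \in Ts).
set p : {poly F} := \prod_(c in Ts :\ b) ('X - (x c)%:P).
have szp : size p = tau.
  rewrite /p -big_enum size_prod_XsubC -cardE -cTs (cardsD1 b Ts) bT //.
have yp : \sum_c y c * p.[x c] = 0.
  under eq_bigr do rewrite horner_coef mulr_sumr.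
  rewrite exchange_big big1 // => t _; transitivity (p`_t * \sum_c y c * x c ^+ t).
    by rewrite mulr_sumr; apply: eq_bigr => c _; rewrite mulrCA.
  by rewrite yx ?mulr0 // -szp.
apply/eqP; move: yp; rewrite (bigD1 b) //= big1 ?addr0 => [/eqP|c cb].
  rewrite mulf_eq0 => /orP[] // /eqP; rewrite horner_prod => /eqP /prodf_eq0 [c].
  rewrite !inE hornerXsubC subr_eq0 => /andP[cb _] /eqP /x_inj bc.
  by rewrite bc eqxx in cb.
have [cT|/y0 ->] := boolP (c \in Ts); last by rewrite mul0r.
rewrite horner_prod (bigD1 c) ?inE ?cb //= hornerXsubC subrr mul0r mulr0 //.
Qed.

(** A polynomial of degree below [tau] with [tau] roots vanishes: interference known at [tau] points
    is known everywhere. *)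
Lemma vandermonde_dual (Ts : {set vserver}) (y : vserver -> F) :
  #|Ts| = tau ->
  (forall b, b \in Ts -> \sum_(t : vserver | (t < tau)%N) x b ^+ t * y t = 0) ->
  forall b, \sum_(t : vserver | (t < tau)%N) x b ^+ t * y t = 0.
Proof.
move=> cTs yT; set p : {poly F} := \sum_(t : vserver | (t < tau)%N) y t *: 'X^t.
have pE b : p.[x b] = \sum_(t : vserver | (t < tau)%N) x b ^+ t * y t.
  by rewrite horner_sum; apply: eq_bigr => t _; rewrite hornerZ hornerXn mulrC.
suff p0 : p = 0 by move=> b; rewrite -pE p0 horner0.
apply: (@roots_geq_poly_eq0 _ p [seq x b | b <- enum Ts]).
- by apply/allP => _ /mapP[b bT ->]; rewrite /root pE yT // -mem_enum.
- by rewrite map_inj_uniq ?enum_uniq.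
rewrite size_map -cardE cTs (leq_trans (size_sum _ _ _)) //.
apply/bigmax_leqP => t tT; rewrite (leq_trans (size_scale_leq _ _)) //.
by rewrite size_polyXn.
Qed.

Lemma decode_zero (i : 'I_M) (Z : 'I_M -> slot -> F) :
  (forall s : slot, [exists m, tau <= s.2 m]%N ->
     \sum_(m | (tau <= s.2 m)%N) \sum_(s' : slot | (tau <= s'.2 m)%N) coef i m s s' * Z m s' = 0) ->
  forall s : slot, (tau <= s.2 i)%N -> Z i s = 0.
Proof.
move=> hZ.
(* All undesired files are coded alike, so their symbols add up to one message [I w], whose codeword
   at [x b] is read in slot [(b, shift i b w)]. *)
pose I (w : word) t := \sum_(m | (m != i) && (tau <= w m)%N) Z m (t, w).
have sumE (s : slot) :
    \sum_(m | (tau <= s.2 m)%N) \sum_(s' : slot | (tau <= s'.2 m)%N) coef i m s s' * Z m s'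
    = (if (tau <= s.2 i)%N then Z i s else 0)
      + \sum_(t : vserver | (t < tau)%N) x s.1 ^+ t * I (shift i (- s.1) s.2) t.
  rewrite (bigID (pred1 i)) /=; congr (_ + _).
    case: ifP => si; last first.
      by rewrite big1 // => m /andP[sm /eqP mi]; rewrite mi si in sm.
    rewrite (big_pred1 i) => [|m]; last by rewrite /= andb_idl // => /eqP ->.
    rewrite (bigD1 s) //= /coef !eqxx mul1r big1 ?addr0 // => s' /andP[_ /negbTE].
    by rewrite eq_sym => ->; rewrite mul0r.
  under [RHS]eq_bigr do rewrite mulr_sumr.
  rewrite exchange_big /=; apply: eq_big => [m|m /andP[sm mi]].
    by rewrite andbC; apply: andb_id2l => /shift_neq ->.
  rewrite (bigID (fun s' : slot => (s'.1 < tau)%N && (s'.2 == shift i (- s.1) s.2))) /=.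
  rewrite [X in _ + X]big1 ?addr0 => [|s' /andP[_ /negbTE cs']]; last first.
    by rewrite /coef (negbTE mi) cs' mul0r.
  rewrite (reindex_onto (fun t : vserver => (t, shift i (- s.1) s.2)) fst) /=; last first.
    by move=> [t w] /= /andP[_ /andP[_ /eqP ->]].
  apply: eq_big => [t|t /andP[/andP[_ /andP[tt _]] _]].
    by rewrite eqxx shift_neq // sm !eqxx !andbT.
  by rewrite /coef (negbTE mi) tt !eqxx.
have I0 w b : \sum_(t : vserver | (t < tau)%N) x b ^+ t * I w t = 0.
  have [|none] := boolP [exists m, (m != i) && (tau <= w m)%N]; last first.
    rewrite big1 // => t _; rewrite /I big_pred0 ?mulr0 // => m.
    by apply: contraNF none => ?; apply/existsP; exists m.
  case/existsP=> m /andP[mi wm].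
  (* Exactly [tau] of the slots [(c, shift i c w)] avoid file [i] and show the interference alone;
     file [m] keeps them active. *)
  have cardS : #|[set c | (w i + c)%R < tau]%N| = tau.
    rewrite -[RHS](card_ord_lt tau_le) -(card_preimset _ (addrI (w i))).
    by apply: eq_card => c; rewrite !inE.
  have dual := vandermonde_dual _ (I w) cardS.
  apply: dual => c.
  rewrite inE => wc; have := hZ (c, shift i c w); rewrite sumE /= shiftK ffunE eqxx.
  rewrite leqNgt wc /= add0r; apply.
  by apply/existsP; exists m; rewrite shift_neq.
move=> s si; have := hZ s; rewrite sumE si I0 addr0; apply.
by apply/existsP; exists i.
Qed.

Lemma sum_idx (V : nmodType) m (f : slot -> V) :
  \sum_j f (idx m j) = \sum_(s : slot | (tau <= s.2 m)%N) f s.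
Proof.
rewrite [RHS](reindex_onto (idx m) (rk m)) => [|s]; last exact: idx_rk.
by apply: eq_bigl => j; rewrite idx_act rk_idx eqxx.
Qed.

(* A colluding set of tau virtual servers sees rows that are linearly
   independent whatever the desired file is, so one change of basis maps them
   to distinct unit vectors. *)
Lemma qrow_basis_change (Ts : {set vserver}) i m :
  #|Ts| = tau ->
  exists2 Phi : 'M[F]_L, Phi \in unitmx &
    forall s, s.1 \in Ts -> qrow i m s = qrow m m s *m Phi.
Proof.
move=> cTs; have [<-|mi] := eqVneq m i.
  by exists 1%:M; rewrite ?unitmx1 // => s _; rewrite mulmx1.
(* [f] stacks the rows for desired file [i]; [U] projects onto the symbols of slots seen by [Ts].
   The point is that [f] is injective on the row space of [U]. *)
pose f : 'M[F]_L := \matrix_j qrow i m (idx m j).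
pose U : 'M[F]_L := \matrix_(j, k) ((j == k) && ((idx m j).1 \in Ts))%:R.
have qE j k : qrow i m (idx m j) 0 k = coef i m (idx m j) (idx m k).
  by rewrite /qrow idx_act mxE.
have rkf : \rank (U *m f) = \rank U.
  apply/mxrank_injP; rewrite -submx0; apply/rV_subP => v.
  rewrite sub_capmx submx0 => /andP[/submxP[y vU] /sub_kermxP vf].
  have vT j : (idx m j).1 \notin Ts -> v 0 j = 0.
    move=> jT; rewrite vU mxE big1 // => k _; rewrite mxE.
    by case: eqP => [->|_]; rewrite ?(negbTE jT) mulr0.
  apply/eqP/rowP => j0; rewrite [RHS]mxE.
  (* Rows sharing the shifted word [w] form one Reed-Solomon block; only the block of [j0]
     matters. *)
  pose w := shift i (- (idx m j0).1) (idx m j0).2.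
  have wm : (tau <= w m)%N by rewrite shift_neq // idx_act.
  have actw b : (tau <= shift i b w m)%N by rewrite shift_neq.
  pose yy b := v 0 (rk m (b, shift i b w)).
  suff y0 : forall b, yy b = 0.
    have := y0 (idx m j0).1; rewrite /yy /w shiftNK -surjective_pairing rk_idx //.
  apply: (vandermonde_supp Ts yy cTs) => [b bT|t tt].
    by apply: vT; rewrite idx_rk //= actw.
  have ta : (t < a.+1)%N by exact: leq_trans tt tau_le.
  (* Coordinate [(t, w)] of [v *m f = 0] is the moment equation of order [t] for [yy]. *)
  pose k := rk m (Ordinal ta, w).
  have := congr1 (fun A : 'rV_L => A 0 k) vf; rewrite !mxE => {}vf.
  rewrite -[RHS]vf; symmetry.
  under eq_bigr do rewrite mxE qE.
  rewrite (bigID (fun j => w == shift i (- (idx m j).1) (idx m j).2)) /=.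
  rewrite [X in _ + X]big1 ?addr0 => [|j jw]; last first.
    by rewrite /coef (negbTE mi) idx_rk //= (negbTE jw) andbF mulr0.
  rewrite (reindex_onto (fun b => rk m (b, shift i b w)) (fun j => (idx m j).1)) /=.
    apply: eq_big => [b|b _].
      by rewrite idx_rk ?actw //= shiftK !eqxx.
    by rewrite /coef (negbTE mi) !idx_rk ?actw //= tt shiftK eqxx.
  by move=> j /eqP ->; rewrite shiftNK -surjective_pairing rk_idx.
(* On the row space of [U], the map [f] agrees with an invertible [g]. *)
have [g gU Ug] := complete_unitmx rkf.
exists g => // s sT; rewrite /qrow; case: ifP => sm; last by rewrite mul0mx.
have eU : \row_j coef m m s (idx m j) = row (rk m s) U.
  apply/rowP => j; rewrite !mxE /coef eqxx idx_rk // sT andbT.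
  by rewrite -(inj_eq (can_inj (rk_idx m))) idx_rk.
rewrite eU -row_mul -Ug row_mul -eU; apply/rowP => k.
rewrite !mxE (bigD1 (rk m s)) //= big1 ?addr0 => [|j js]; rewrite !mxE /coef eqxx.
  by rewrite idx_rk // eqxx mul1r /qrow sm mxE /coef (negbTE mi).
case: eqP => [sj|]; last by rewrite mul0r.
by rewrite sj rk_idx eqxx in js.
Qed.

End VirtualServers.

(** * Counting slots, words and observed virtual servers *)

Lemma card_slots a tau M (m : 'I_M) : (tau <= a.+1)%N ->
  #|[set s : 'I_a.+1 * {ffun 'I_M -> 'I_a.+1} | (tau <= s.2 m)%N]|
  = ((a.+1 - tau) * a.+1 ^ M)%N.
Proof.
move=> tau_le.
(* Swapping the server with letter [m] turns the condition on the word into one on the server. *)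
pose h (s : 'I_a.+1 * {ffun 'I_M -> 'I_a.+1}) : 'I_a.+1 * {ffun 'I_M -> 'I_a.+1} :=
  (s.2 m, [ffun m' => if m' == m then s.1 else s.2 m']).
have hK : involutive h.
  move=> [b v]; rewrite /h /= ffunE eqxx; congr (_, _); apply/ffunP => m'.
  by rewrite !ffunE; case: eqP => [->|].
have -> : [set s : 'I_a.+1 * {ffun 'I_M -> 'I_a.+1} | (tau <= s.2 m)%N]
   = h @^-1: setX (~: [set c : 'I_a.+1 | (c < tau)%N]) setT.
  by apply/setP => s; rewrite !inE andbT -leqNgt.
rewrite card_preimset; last exact: inv_inj.
by rewrite cardsX cardsCs setCK card_ord_lt // cardsT card_ffun !card_ord.
Qed.

Lemma card_active_words a tau M : (tau <= a.+1)%N ->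
  #|[set v : {ffun 'I_M -> 'I_a.+1} | [exists m, tau <= v m]%N]| = (a.+1 ^ M - tau ^ M)%N.
Proof.
move=> tau_le; rewrite cardsCs card_ffun !card_ord; congr (_ - _)%N.
rewrite -[X in (X ^ _)%N](card_ord_lt tau_le) -[X in (_ ^ X)%N]card_ord -card_ffun_on.
apply: eq_card => v; rewrite !inE negb_exists; apply: eq_forallb => m.
by rewrite inE -ltnNge.
Qed.

Lemma enum_set {T : finType} {A : {set T}} {n : nat} : #|A| = n -> (0 < n)%N ->
  exists (f : 'I_n -> T) (g : T -> 'I_n),
    [/\ cancel f g, forall t, t \in A -> f (g t) = t & forall j, f j \in A].
Proof.
move=> <- A0; have [t0 t0A] : exists t0, t0 \in A by apply/card_gt0P.
exists enum_val, (enum_rank_in t0A); split.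
- exact: enum_valK_in.
- exact: enum_rankK_in.
- exact: enum_valP.
Qed.

(** The draws missing [Ts] are the [K]-subsets of its complement. This counts the virtual servers
    that the colluders observe. *)
Lemma card_hitting_draws {I : finType} {N K T : nat} (B : I -> {set 'I_N}) (Ts : {set 'I_N}) :
  injective B -> (forall A : {set 'I_N}, (#|A| == K) = (A \in codom B)) -> #|Ts| = T ->
  #|[set b | ~~ [disjoint B b & Ts]]| = ('C(N, K) - 'C(N - T, K))%N.
Proof.
move=> B_inj B_codom cT.
have cB (P : pred {set 'I_N}) : #|[set b | P (B b)]| = #|[set A : {set 'I_N} | P A & #|A| == K]|.
  rewrite -(card_imset _ B_inj); apply: eq_card => A; apply/imsetP/idP => [[b]|].
    by rewrite inE => Pb ->; rewrite inE Pb B_codom codom_f.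
  rewrite inE B_codom => /andP[PA /codomP[b Ab]]; exists b => //.
  by rewrite inE -Ab.
have cI : #|I| = 'C(N, K).
  rewrite -cardsT (eq_card (B := [set b | predT (B b)])) => [|b]; last by rewrite !inE.
  by rewrite cB -[in RHS](card_ord N) -card_draws; apply: eq_card => A; rewrite !inE.
rewrite cardsCs cI; congr (_ - _)%N.
rewrite (_ : (N - T)%N = #|~: Ts|); last by rewrite cardsCs setCK cT card_ord.
rewrite -cards_draws -(cB (fun A : {set 'I_N} => A \subset ~: Ts)).
by apply: eq_card => b; rewrite !inE negbK disjoints_subset.
Qed.

Lemma geometric_sum_ratio {R : fieldType} (A t : R) M : A != 0 -> A - t != 0 ->
  \sum_(m < M) (t / A) ^+ m = A * (A ^+ M - t ^+ M) / ((A - t) * A ^+ M).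
Proof.
move=> A0 At0; have r1 : t / A - 1 != 0.
  by rewrite -opprB oppr_eq0 -(mulfV A0) -mulrBl mulf_neq0 ?invr_eq0.
apply: (mulfI r1); rewrite -subrX1 expr_div_n.
by field; rewrite A0 At0 expf_neq0.
Qed.

(** * The scheme and its probability space *)

Section Scheme.
Context {R : realType} {F : finFieldType} {N K M a tau L : nat}.
Local Notation vserver := 'I_a.+1.
Local Notation slot := ('I_a.+1 * {ffun 'I_M -> 'I_a.+1})%type.

Context (x : vserver -> F) (idx : 'I_M -> 'I_L -> slot) (rk : 'I_M -> slot -> 'I_L)
  (B : vserver -> {set 'I_N}) (G : 'M[F]_(K, N)).
Hypothesis x_inj : injective x.
Hypothesis tau_le : (tau <= a.+1)%N.
Hypothesis idx_rk : forall m (s : slot), (tau <= s.2 m)%N -> idx m (rk m s) = s.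
Hypothesis rk_idx : forall m, cancel (idx m) (rk m).
Hypothesis idx_act : forall m j, (tau <= (idx m j).2 m)%N.
Hypothesis card_B : forall b, #|B b| = K.
Hypothesis G_MDS : MDS_gen G.
Hypothesis M_gt0 : (0 < M)%N.

Definition basis_changes : finType := {ffun 'I_M -> {A : 'M[F]_L | A \in unitmx}}.
Definition pads : finType := {ffun slot -> F}.

Definition active (s : slot) : bool := [exists m, tau <= s.2 m]%N.

Definition pir_query (i : 'I_M) (u : basis_changes) (n : 'I_N) : {ffun slot -> 'M[F]_(M, L)} :=
  [ffun s => if n \in B s.1 then \matrix_m (qrow (tau := tau) x idx i m s *m val (u m)) else 0].

(* The common randomness g is used as a one-time pad: it makes the answers
   exactly uniform and, being known to the user, does not affect decoding. *)
Definition pir_answer (n : 'I_N) (q : {ffun slot -> 'M[F]_(M, L)}) (g : pads)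
    (y : 'M[F]_(M, L)) : {ffun slot -> F} :=
  [ffun s => if (n \in B s.1) && active s then \sum_m \sum_j q s m j * y m j + g s else 0].

Definition scheme : PIR_scheme R F N M L :=
  @PIRScheme R F N M L basis_changes (fun=> (#|basis_changes|%:R)^-1)
    pads (fun=> (#|pads|%:R)^-1) {ffun slot -> 'M[F]_(M, L)} pir_query
    {ffun slot -> F} pir_answer.

Local Notation P := (omega_pmf (K := K) (S := scheme)).

Lemma uniform_pmf (T : finType) (t : T) : is_pmf (fun _ : T => (#|T|%:R)^-1 : R).
Proof.
split=> [_|]; first by rewrite invr_ge0 ler0n.
by rewrite sumr_const -(mulr_natl (_^-1)) mulfV // pnatr_eq0 -lt0n; apply/card_gt0P; exists t.
Qed.

Lemma user_uniform : is_pmf (user_pmf scheme).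
Proof. exact: (uniform_pmf basis_changes [ffun=> exist _ 1%:M (unitmx1 F L)]). Qed.

Lemma serv_uniform : is_pmf (serv_pmf scheme).
Proof. exact: (uniform_pmf pads [ffun=> 0]). Qed.

Lemma omega_is_pmf : is_pmf P.
Proof.
case: user_uniform => u0 u1; case: serv_uniform => s0 s1.
case: (uniform_pmf {: files_t F M L K} 0) => f0 f1.
split=> [w|]; first by rewrite /omega_pmf /= !mulr_ge0 ?invr_ge0 ?ler0n.
rewrite -(pair_bigA _ (fun ug W => P (ug, W))) /= /omega_pmf /=.
under eq_bigr do rewrite -mulr_sumr f1 mulr1.
rewrite -(pair_bigA _ (fun u g => user_pmf scheme u * serv_pmf scheme g)) /=.
by under eq_bigr do rewrite -mulr_sumr s1 mulr1.
Qed.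

Lemma omegaI_is_pmf : is_pmf (omegaI_pmf (K := K) (S := scheme)).
Proof.
case: omega_is_pmf => p0 p1; split=> [w|]; first by rewrite mulr_ge0 // invr_ge0 ler0n.
rewrite -(pair_bigA _ (fun i w => (M%:R)^-1 * P w)) /=.
under eq_bigr do rewrite -mulr_sumr p1 mulr1.
by rewrite sumr_const card_ord -(mulr_natl (_^-1)) mulfV // pnatr_eq0 -lt0n.
Qed.

Lemma queries_files_indep i :
  mutual_info P (RV_queries (S := scheme) i) (RV_files (S := scheme)) = 0.
Proof.
rewrite mutual_infoC; apply: (mutual_info_symmetry P omega_is_pmf) => W W'.
exists (fun w => (w.1, w.2 + (W' - W))); split.
  by move=> [ug1 V1] [ug2 V2] _ _ /= [-> /addIr ->].
by move=> [ug V] /= ->; split => //; rewrite addrC subrK.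
Qed.

Lemma entropy_file i : entropy P (RV_file (S := scheme) i) = ln (#|F|%:R) *+ (L * K).
Proof.
rewrite (entropy_uniform P omega_is_pmf _ setT) => [|w|V V' _ _]; last 1 first.
- exists (fun w => (w.1, w.2 + [ffun m => if m == i then V' - V else 0])); split.
    by move=> [ug1 V1] [ug2 V2] _ _ /= [-> /addIr ->].
  by move=> [ug W] /=; rewrite /RV_file /= => WV; split=> //; rewrite !ffunE eqxx WV addrC subrK.
- by rewrite cardsT card_mx natrX lnXn // ltr0n; apply/card_gt0P; exists 0.
- by rewrite inE.
Qed.

Lemma entropy_answer i n : entropy P (RV_answer (S := scheme) G i n)
  = ln (#|F|%:R) *+ #|[set s : slot | (n \in B s.1) && active s]|.
Proof.
set D := [set s : slot | _].
pose E := [set f : {ffun slot -> F} | f \in pffun_on 0 D predT].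
have EP (f : {ffun slot -> F}) : reflect (forall s, s \notin D -> f s = 0) (f \in E).
  rewrite inE; apply: (iffP pffun_onP) => [[fD _] s sD|f0].
    by apply/eqP; apply: contraNT sD => fs; apply: (subsetP fD); rewrite inE.
  split=> //; apply/subsetP => s; rewrite inE; apply: contraR => /f0 ->.
  by rewrite eqxx.
rewrite (entropy_uniform P omega_is_pmf _ E) => [|w|f f' /EP f0 /EP f'0].
- rewrite cardsE card_pffun_on natrX lnXn //.
  by rewrite ltr0n; apply/card_gt0P; exists 0.
- by apply/EP => s; rewrite inE ffunE => /negbTE ->.
(* Translating the pad by [f' - f] carries answer [f] to [f']; off [D] both are zero. *)
exists (fun w => (w.1.1, w.1.2 + (f' - f), w.2)); split.
  by move=> [[u1 g1] V1] [[u2 g2] V2] _ _ /= [-> /addIr -> ->].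
move=> [[u g] W] /=; rewrite /RV_answer /= => wf; split=> //; apply/ffunP => s.
move/ffunP/(_ s): wf; rewrite !ffunE; case: ifP => [_ <-|sD _].
  by rewrite opprD addrA [_ + g s]addrC !addrA; ring.
by rewrite f'0 // inE sD.
Qed.

(** Left multiplication of each secret matrix by an invertible [Phi m] is a bijection and
    compensates for the change of desired file. *)
Lemma query_relabelling (Tset : {set 'I_N}) i i' :
  #|[set b | ~~ [disjoint B b & Tset]]| = tau ->
  exists2 phi : basis_changes -> basis_changes, injective phi &
    forall u n, n \in Tset -> pir_query i' (phi u) n = pir_query i u n.
Proof.
set V := [set b | _] => cV.
have /fin_all_exists2 [Phi PhiU PhiE] (m : 'I_M) : exists2 Phi : 'M[F]_L, Phi \in unitmx &
    forall s, s.1 \in V -> qrow (tau := tau) x idx i m s = qrow (tau := tau) x idx i' m s *m Phi.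
  have basis j := qrow_basis_change x idx rk x_inj tau_le idx_rk rk_idx idx_act V j m cV.
  have [[f fU fE] [f' f'U f'E]] := (basis i, basis i').
  (* Both desired indices are compared with the uncoded rows [qrow m m]. *)
  exists (invmx f' *m f); first by rewrite unitmx_mul unitmx_inv f'U.
  by move=> s sV; rewrite fE // f'E // mulmxA mulmxK.
(* Invertible matrices are closed under products, so [insubd] returns the product itself. *)
exists (fun u : basis_changes => [ffun m => insubd (u m) (Phi m *m val (u m))]).
  move=> u u' /ffunP uu'; apply/ffunP => m; move/(congr1 val): (uu' m).
  rewrite !ffunE !val_insubd !unitmx_mul !(PhiU m) (valP (u m)) (valP (u' m)) /=.
  by move=> e; apply: val_inj; rewrite -(mulKmx (PhiU m) (val (u m))) e mulKmx.
move=> u n nT; apply/ffunP => s; rewrite !ffunE; case: ifP => // ns.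
have sV : s.1 \in V by rewrite inE; apply/pred0Pn; exists n; apply/andP.
apply/row_matrixP => m; rewrite !rowK ffunE val_insubd unitmx_mul PhiU (valP (u m)) /=.
by rewrite mulmxA -PhiE.
Qed.

(** Replacing [i] by [i'] and [u] by [phi u] keeps the uniform law; pads and files stay fixed, so
    equal queries give equal answers. *)
Lemma scheme_private (Tset : {set 'I_N}) :
  #|[set b | ~~ [disjoint B b & Tset]]| = tau ->
  mutual_info (omegaI_pmf (K := K) (S := scheme)) (RV_index (S := scheme))
    (RV_queries_T (S := scheme) Tset) = 0 /\
  mutual_info (omegaI_pmf (K := K) (S := scheme)) (RV_index (S := scheme))
    (RV_answers_T G (S := scheme) Tset) = 0.
Proof.
move=> cV; split; apply: (mutual_info_symmetry _ omegaI_is_pmf) => i i';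
  have [phi phi_inj phiE] := query_relabelling Tset i i' cV;
  exists (fun w => (i', (phi w.2.1.1, w.2.1.2, w.2.2))); split.
1,3: by move=> [j [[u g] W]] [j' [[u' g'] W']] /eqP /= -> /eqP /= -> [/phi_inj -> -> ->].
all: move=> [j [[u g] W]] /= ji; rewrite /RV_index /= in ji; subst j; split=> //.
all: apply/ffunP => n; rewrite !ffunE; case: ifP => // nT; congr Some.
  by rewrite /RV_query /= phiE.
by rewrite /RV_answer /= phiE.
Qed.

(** * Decodability *)

Lemma query_times_store (X : 'I_M -> 'rV[F]_L) (W : files_t F M L K) n :
  \sum_m \sum_j (\matrix_m X m) m j * store G W n m j = ((\sum_m X m *m W m) *m G) 0 n.
Proof.
rewrite mulmx_suml summxE; apply: eq_bigr => m _; rewrite -mulmxA mxE.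
by apply: eq_bigr => j _; rewrite !mxE.
Qed.

(** The [K] columns of [G] indexed by [B b] form an invertible matrix, so these servers jointly
    reveal the value of the query. *)
Lemma MDS_zero (b : vserver) (r : 'rV[F]_K) :
  (forall n, n \in B b -> (r *m G) 0 n = 0) -> r = 0.
Proof.
move=> r0; pose f (k : 'I_K) : 'I_N := enum_val (cast_ord (esym (card_B b)) k).
have f_inj : injective f by move=> k k' /enum_val_inj /cast_ord_inj.
have GU : colsub f G \in unitmx by rewrite -row_free_unit /row_free (G_MDS f).
rewrite -(mulmxK GU r) (_ : r *m _ = 0) ?mul0mx //.
apply/rowP => k; rewrite [RHS]mxE -(r0 (f k)) ?enum_valP // !mxE.
by apply: eq_bigr => j _; rewrite mxE.
Qed.

Lemma scheme_decodable i :
  cond_entropy P (RV_file (S := scheme) i)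
    (fun w => (RV_queries (S := scheme) i w, RV_answers G (S := scheme) i w, w.1.1, w.1.2)) = 0.
Proof.
apply: cond_entropy_determined => -[[u g] W] [[u' g'] W'] /= [_ eA eu eg].
rewrite /RV_file /= -{u'}eu -{g'}eg in eA *.
pose D m := W m - W' m.
have r0 (s : slot) : active s -> \sum_m (qrow (tau := tau) x idx i m s *m val (u m)) *m D m = 0.
  move=> act_s; apply: (MDS_zero s.1) => n ns.
  under eq_bigr do rewrite mulmxBr.
  rewrite sumrB mulmxBl [LHS]mxE [X in _ + X]mxE -!query_times_store; apply/eqP.
  rewrite subr_eq0; apply/eqP; apply: (addIr (g s)).
  move/ffunP/(_ n)/ffunP/(_ s): eA; rewrite !ffunE ns act_s /=.
  exact.
suff uD0 : val (u i) *m D i = 0.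
  by apply/eqP; rewrite -subr_eq0; apply/eqP; rewrite -[LHS](mulKmx (valP (u i))) uD0 mulmx0.
apply/matrixP => j k; rewrite [RHS]mxE.
(* Decoding goes column by column: [Z m] is column [k] of the difference in the secret basis,
   indexed by slots. *)
pose Z m s := (val (u m) *m D m) (rk m s) k.
have := decode_zero x x_inj tau_le i Z _ (idx i j) (idx_act i j).
rewrite /Z rk_idx; apply => s act_s.
have := congr1 (fun A : 'rV_K => A 0 k) (r0 s act_s); rewrite summxE.
rewrite [X in _ = X]mxE => r0k; rewrite -[RHS]r0k.
rewrite big_mkcond; apply: eq_bigr => m _; rewrite -mulmxA [RHS]mxE.
case: ifP => sm; last by rewrite big1 // => l _; rewrite /qrow sm mxE mul0r.
rewrite -(sum_idx idx rk idx_rk rk_idx idx_act).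
by apply: eq_bigr => l _; rewrite /qrow sm [X in _ = X * _]mxE /Z rk_idx.
Qed.

(** * Rate *)

(** Each active slot is asked of [K] servers, and activity depends on the word alone. *)
Lemma total_download :
  (\sum_(n < N) #|[set s : slot | (n \in B s.1) && active s]| = a.+1 * (a.+1 ^ M - tau ^ M) * K)%N.
Proof.
under eq_bigr do rewrite cardsE -sum1_card.
rewrite (exchange_big_dep active) /= => [|n s _]; last by case/andP.
rewrite (eq_bigr (fun=> K)) => [|s act_s]; last first.
  by rewrite -(card_B s.1) -sum1_card; apply: eq_bigl => n; rewrite unfold_in act_s andbT.
rewrite sum_nat_const; congr (_ * _)%N.
rewrite -(card_active_words a tau M tau_le) -[X in (X * _)%N]card_ord -cardsT -cardsX -cardsE.
by apply: eq_card => s; rewrite !inE.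
Qed.

Lemma scheme_rate i : L = ((a.+1 - tau) * a.+1 ^ M)%N -> (0 < K)%N -> (tau < a.+1)%N ->
  PIR_rate G scheme i = (\sum_(m < M) (tau%:R / a.+1%:R) ^+ m)^-1.
Proof.
move=> LE K_gt0 tau_lt; rewrite /PIR_rate entropy_file.
under eq_bigr do rewrite entropy_answer.
rewrite sumrMnr total_download -[ln _ *+ (L * K)]mulr_natl -[ln _ *+ (_ * K)]mulr_natl.
have lnF : ln (#|F|%:R : R) != 0 by rewrite gt_eqF // ln_gt0 // ltr1n card_finNzRing_gt1.
have K0 : (K%:R : R) != 0 by rewrite pnatr_eq0 -lt0n.
have a0 : (a.+1%:R : R) != 0 by rewrite pnatr_eq0.
have at0 : (a.+1%:R - tau%:R : R) != 0 by rewrite subr_eq0 eqr_nat gtn_eqF.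
rewrite -mulf_div divff // mulr1 !natrM -mulf_div divff // mulr1.
rewrite LE natrM natrX natrB // natrB ?leq_exp2r // !natrX.
by rewrite geometric_sum_ratio // invf_div.
Qed.

End Scheme.

Theorem theorem1 (R : realType) (N K T M : nat) :
  (0 < N)%N -> (0 < K)%N -> (0 < T)%N -> (0 < M)%N ->
  (K <= N)%N -> (T <= N)%N -> (T + K <= N)%N ->
  exists q0 : nat,
    forall F : finFieldType, (q0 <= #|{: F}|)%N ->
    forall G : 'M[F]_(K, N), MDS_gen G ->
    exists (L : nat) (S : PIR_scheme R F N M L),
      [/\ (0 < L)%N, is_PIR_scheme G S T &
          forall i : 'I_M, PIR_rate G S i = target_rate R N K T M].
Proof.
move=> N_gt0 K_gt0 T_gt0 M_gt0 KN TN TKN.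
(* The field must supply distinct evaluation points [x b], one per virtual server. *)
exists 'C(N, K) => F cF G G_MDS.
have [a aE] : exists a, 'C(N, K) = a.+1.
  by exists 'C(N, K).-1; rewrite prednK // bin_gt0.
pose tau := ('C(N, K) - 'C(N - T, K))%N.
have binT_le : ('C(N - T, K) <= 'C(N, K))%N by rewrite leq_bin2l // leq_subr.
(* By [T + K <= N] some virtual server escapes the colluders, whence [tau < a.+1] and [0 < L]. *)
have binT_gt0 : (0 < 'C(N - T, K))%N by rewrite bin_gt0 leq_subRL.
have tau_lt : (tau < a.+1)%N by rewrite -aE /tau; lia.
have tau_le := ltnW tau_lt.
rewrite aE in cF; pose x (b : 'I_a.+1) : F := enum_val (widen_ord cF b).
have x_inj : injective x by move=> b c /enum_val_inj /(congr1 val) /= ?; exact: val_inj.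
pose L := ((a.+1 - tau) * a.+1 ^ M)%N.
have L_gt0 : (0 < L)%N by rewrite muln_gt0 subn_gt0 tau_lt expn_gt0.
have /fin_all_exists [idx] (m : 'I_M) := enum_set (card_slots a tau M m tau_le) L_gt0.
case/fin_all_exists => rk idxP.
have idx_rk m (s : 'I_a.+1 * {ffun 'I_M -> 'I_a.+1}) : (tau <= s.2 m)%N -> idx m (rk m s) = s.
  by move=> sm; case: (idxP m) => _ + _; apply; rewrite inE.
have rk_idx m : cancel (idx m) (rk m) by case: (idxP m).
have idx_act m j : (tau <= (idx m j).2 m)%N.
  by case: (idxP m) => _ _ /(_ j); rewrite inE.
have cdraws : #|[set A : {set 'I_N} | #|A| == K]| = a.+1 by rewrite card_draws card_ord.
have [B [B' [BK B'K BP]]] := enum_set cdraws (ltn0Sn a).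
have card_B b : #|B b| = K by have := BP b; rewrite inE => /eqP.
have B_codom (A : {set 'I_N}) : (#|A| == K) = (A \in codom B).
  apply/idP/codomP => [AK|[b ->]]; last by rewrite card_B.
  by exists (B' A); rewrite B'K // inE.
exists L, (scheme (tau := tau) x idx B); split=> // [|i].
  split.
  - exact: user_uniform.
  - exact: serv_uniform.
  - by move=> i; apply: queries_files_indep.
  - by move=> i; apply: (scheme_decodable x idx rk).
  - move=> Tset cT; apply: (scheme_private x idx rk) => //.
    exact: (card_hitting_draws B Tset (can_inj BK) B_codom cT).
rewrite (scheme_rate x idx B G) // /target_rate; congr (_^-1); apply: eq_bigr => m _.
congr (_ ^+ _); rewrite /tau natrB // aE mulrBl divff ?pnatr_eq0 //.
Qed.
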